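(* Let $k$ be a field, $R=k[x_1,\dots,x_n]$, and let $I\subseteq R$ be the edge ideal of a hypergraph $\mathcal H$ on the vertex set $V=\{1,\dots,n\}$. Let $\Delta$ be the simplicial complex of the independent sets of $\mathcal H$ and $\Delta^{(1)}$ its 1-dimensional skeleton. Assume that $\operatorname{depth} R/I^2>1$. Then $\operatorname{diam}\Delta^{(1)}\le 2$.
   Context: A hypergraph $\mathcal H$ on $V=\{1,\dots,n\}$ is a set of subsets of $V$ (its edges); containments between edges are allowed. The edge ideal of $\mathcal H$ is the ideal of $R$ generated by all $x^F=\prod_{i\in F}x_i$, $F\in\mathcal H$. Depth is taken with respect to $(x_1,\dots,x_n)$. A set $F\subseteq V$ is independent if it does not contain any edge of $\mathcal H$; thus $I$ is the Stanley-Reisner ideal of $\Delta$. $\Delta^{(1)}$ is the graph whose vertices are the $i\in V$ with $\{i\}\in\Delta$ and whose edges are the 1-dimensional faces of $\Delta$. The diameter of a graph is the maximal distance between two of its vertices, where distance is the minimal length of a path joining them ($\infty$ if there is none); a graph with at most one vertex has diameter $0$. *)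

(* Defs.v *)
From HB Require Import structures.
From mathcomp Require Import all_boot all_order all_algebra.
From mathcomp Require Import mpoly boolp.
Set Implicit Arguments.
Unset Strict Implicit.
Unset Printing Implicit Defensive.
Import GRing.Theory.
Local Open Scope ring_scope.
Local Open Scope quotient_scope.

(* Natural numbers extended by infinity: [Some d] is finite, [None] infinite. *)
Definition enat := option nat.

Definition infty : enat := None.

Definition ele (d e : enat) : bool :=
  match d, e with
  | _, None => true
  | None, Some _ => false
  | Some a, Some b => (a <= b)%N
  end.

Definition elt (d e : enat) : bool := ~~ ele e d.

Lemma asbool_ex (P : nat -> Prop) : (exists d, P d) -> exists d, `[< P d >].
Proof. by case=> d Pd; exists d; apply/asboolP. Qed.

(* The infimum of a set of naturals, infinite when the set is empty. *)
Definition einf (P : nat -> Prop) : enat :=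
  if pselect (exists d, P d) is left exP then Some (ex_minn (asbool_ex exP))
  else infty.

(* The supremum of a set of extended naturals, i.e. its least upper bound;
   it is 0 when the set is empty. *)
Definition esup (P : enat -> Prop) : enat :=
  einf (fun b => forall d, P d -> ele d (Some b)).

Section Submodules.
Variables (R : comNzRingType) (M : lmodType R).

Definition submod_gen (G : M -> Prop) : {pred M} := fun u =>
  `[< exists s : seq (R * M),
        (forall x, x \in s -> G x.2) /\ u = \sum_(x <- s) x.1 *: x.2 >].

Lemma submod_gen_closed G : submod_closed (submod_gen G).
Proof.
split; first by apply/asboolP; exists [::]; rewrite big_nil.
move=> a u v /asboolP [s [Gs ->]] /asboolP [t [Gt ->]]; apply/asboolP.
exists ([seq (a * x.1, x.2) | x <- s] ++ t); split.
  move=> x; rewrite mem_cat => /orP[/mapP[y ys ->]|]; last exact: Gt.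
  exact: Gs ys.
rewrite big_cat big_map scaler_sumr; congr (_ + _).
by apply: eq_bigr => x _; rewrite scalerA.
Qed.

HB.instance Definition _ G :=
  GRing.isSubmodClosed.Build R M (submod_gen G) (submod_gen_closed G).

(* The submodule A M, for a subset A of R. *)
Definition smul_mod (A : {pred R}) : {pred M} :=
  submod_gen (fun v => exists a u, a \in A /\ v = a *: u).

End Submodules.
Arguments smul_mod {R} M A.

Section QuotientModule.
Variables (R : comNzRingType) (V : lmodType R) (S : submodClosed V).

Lemma submod_oppr_closed : oppr_closed S.
Proof. by move=> u uS; rewrite -scaleN1r rpredZ. Qed.

Definition submod_zmod : zmodClosed V :=
  HB.pack (GRing.SubmodClosed.sort S)
    (GRing.isOppClosed.Build V (GRing.SubmodClosed.sort S) submod_oppr_closed).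

Local Notation Q := (Quotient.quot submod_zmod).

Definition quot_scale (a : R) (u : Q) : Q := \pi_Q (a *: repr u).

Lemma pi_scale a v : \pi_Q (a *: v) = quot_scale a (\pi_Q v).
Proof.
apply/eqP; rewrite -Quotient.idealrBE -scalerBr.
have vS : v - repr (\pi_Q v) \in submod_zmod by rewrite Quotient.idealrBE reprK.
exact: (@rpredZ _ _ S a _ vS).
Qed.

Lemma quot_scaleA a b u : quot_scale a (quot_scale b u) = quot_scale (a * b) u.
Proof. by elim/quotW: u => v; rewrite -(pi_scale b v) -!pi_scale scalerA. Qed.

Lemma quot_scale1 : left_id 1 quot_scale.
Proof. by elim/quotW=> v; rewrite -pi_scale scale1r. Qed.

Lemma quot_scaleDr : right_distributive quot_scale +%R.
Proof.
move=> a; elim/quotW=> u; elim/quotW=> v.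
by rewrite -raddfD -!pi_scale scalerDr raddfD.
Qed.

Lemma quot_scaleDl u : {morph quot_scale^~ u : a b / a + b}.
Proof. by move=> a b; elim/quotW: u => v; rewrite -!pi_scale scalerDl raddfD. Qed.

HB.instance Definition _ := GRing.Zmodule_isLmodule.Build R Q
  quot_scaleA quot_scale1 quot_scaleDr quot_scaleDl.

Definition quotmod : lmodType R := Q.

End QuotientModule.

Section Depth.
Variables (R : comNzRingType) (M : lmodType R).

(* Each f_i is a nonzerodivisor on M / (f_0, ..., f_{i-1}) M, and
   M / (f_0, ..., f_{r-1}) M is nonzero. *)
Definition regular_seq (f : seq R) : Prop :=
  (forall i, (i < size f)%N -> forall u : M,
     f`_i *: u \in smul_mod M (mem (take i f)) ->
     u \in smul_mod M (mem (take i f))) /\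
  (exists u : M, u \notin smul_mod M (mem f)).

(* Convention: the depth is infinite when J M = M, e.g. when M = 0. *)
Definition depth (J : {pred R}) : enat :=
  if `[< forall u : M, u \in smul_mod M J >] then infty
  else esup (fun d => exists f : seq R,
    [/\ {subset f <= J}, regular_seq f & d = Some (size f)]).

End Depth.

Section Ideals.
Variable R : comNzRingType.

(* Ideals of R are the submodules of the regular module R^o. *)
Definition ideal_gen (G : R -> Prop) : {pred R^o} := submod_gen (M := R^o) G.
HB.instance Definition _ G := GRing.SubmodClosed.on (ideal_gen G).

Definition ideal_mul (I J : {pred R^o}) : {pred R^o} :=
  ideal_gen (fun p => exists a b, [/\ a \in I, b \in J & p = a * b]).
HB.instance Definition _ I J := GRing.SubmodClosed.on (ideal_mul I J).

End Ideals.

Section Hypergraphs.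
Variables (k : fieldType) (n : nat).

Definition hypergraph := {set {set 'I_n}}.

Definition edge_monomial (F : {set 'I_n}) : {mpoly k[n]} := \prod_(i in F) 'X_i.

Definition edge_ideal (H : hypergraph) : {pred {mpoly k[n]}^o} :=
  ideal_gen (fun p => exists2 F, F \in H & p = edge_monomial F).
HB.instance Definition _ H := GRing.SubmodClosed.on (edge_ideal H).

Definition irrelevant_ideal : {pred {mpoly k[n]}^o} :=
  ideal_gen (fun p => exists i : 'I_n, p = 'X_i).
HB.instance Definition _ := GRing.SubmodClosed.on irrelevant_ideal.

Definition independent (H : hypergraph) (F : {set 'I_n}) : bool :=
  [forall E in H, ~~ (E \subset F)].

Definition independence_complex (H : hypergraph) : {set {set 'I_n}} :=
  [set F | independent H F].

End Hypergraphs.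
Arguments edge_monomial k {n} F.
Arguments edge_ideal k {n} H.
Arguments irrelevant_ideal k n : clear implicits.

(* A finite simple graph, given by its vertex set and its adjacency relation. *)
Record graph (T : finType) := Graph {
  vertices : {set T};
  adj : rel T;
  adj_sym : ssrbool.symmetric adj;
  adj_irr : irreflexive adj;
  adj_vertices : forall x y, adj x y -> x \in vertices
}.

Section Diameter.
Variables (T : finType) (G : graph T).

Definition distance (x y : T) : enat :=
  einf (fun d => exists p : seq T,
    [/\ path (adj G) x p, last x p = y & size p = d]).

Definition diameter : enat :=
  esup (fun d => exists x y,
    [/\ x \in vertices G, y \in vertices G & d = distance x y]).

End Diameter.

Section Skeleton.
Variables (n : nat) (H : hypergraph n).
Local Notation Delta := (independence_complex H).

Definition skeleton_adj (i j : 'I_n) : bool :=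
  (i != j) && ([set i; j] \in Delta).

Lemma skeleton_adj_sym : ssrbool.symmetric skeleton_adj.
Proof. by move=> i j; rewrite /skeleton_adj eq_sym setUC. Qed.

Lemma skeleton_adj_irr : irreflexive skeleton_adj.
Proof. by move=> i; rewrite /skeleton_adj eqxx. Qed.

Lemma skeleton_adj_vertices i j :
  skeleton_adj i j -> i \in [set i | [set i] \in Delta].
Proof.
case/andP=> _; rewrite !inE => /forall_inP ind; apply/forall_inP => E HE.
by apply: contra (ind E HE) => /subset_trans; apply; rewrite sub1set set21.
Qed.

Definition skeleton1 : graph 'I_n :=
  Graph skeleton_adj_sym skeleton_adj_irr skeleton_adj_vertices.

End Skeleton.

(* Main.v *)
(* Suppose that i and j are vertices at distance greater than 2, put w = x_i x_j
   and let S be the set of the l with {i, l} in Delta. Then phi(x_l) = x_l w for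
   l in S and phi(x_l) = 0 for l not in S defines a homomorphism from
   (x_1, ..., x_n) to R/I^2: if l is in S and m is not, then x_j x_l and x_i x_m
   lie in I, hence x_l x_m w lies in I^2. Depth at least 2 forces phi to be the
   multiplication by some h. As i is in S and j is not, x_i (w - h) and x_j h lie
   in I^2; but x_i w and x_j w do not occur in elements of I^2, so the coefficient
   of w in h is both 1 and 0. (This phi is a class in the degree w part of the
   first local cohomology, witnessing the disconnectedness of the star of i from
   the star of j.) *)
Require Import Defs.
From HB Require Import structures.
From mathcomp Require Import all_boot all_order all_algebra.
From mathcomp Require Import mpoly boolp.
From mathcomp Require Import ring.
Set Implicit Arguments.
Unset Strict Implicit.
Unset Printing Implicit Defensive.
Import GRing.Theory.
Local Open Scope ring_scope.
Local Open Scope quotient_scope.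

(** * Extended naturals, submodules of the form [A M], and depth *)

Lemma einf_le (P : nat -> Prop) d : P d -> ele (einf P) (Some d).
Proof.
move=> Pd; rewrite /einf; case: pselect => [exP|]; last by case; exists d.
by case: ex_minnP => m _ min_m; apply/min_m/asboolP.
Qed.

Lemma esup_le (P : enat -> Prop) b :
  (forall d, P d -> ele d (Some b)) -> ele (esup P) (Some b).
Proof. exact: einf_le. Qed.

Lemma in_smul_mod (R : comNzRingType) (M : lmodType R) (A : {pred R}) (u : M) :
  u \in smul_mod M A ->
  exists s : seq (R * M),
    (forall x, x \in s -> x.1 \in A) /\ u = \sum_(x <- s) x.1 *: x.2.
Proof.
case/asboolP=> s [sA ->]; elim: s sA => [|[r v] s IHs] sA.
  by exists [::]; rewrite !big_nil.
have [|t [tA eqt]] := IHs; first by move=> x xs; apply: sA; rewrite inE xs orbT.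
have [a [v' [aA /= ->]]] := sA _ (mem_head _ _).
exists ((a, r *: v') :: t); split.
  by move=> x; rewrite inE => /predU1P[->|/tA].
by rewrite !big_cons eqt /= !scalerA mulrC.
Qed.

Lemma smul_mod0 (R : comNzRingType) (M : lmodType R) (u : M) :
  u \in smul_mod M (mem [::]) -> u = 0.
Proof.
case/in_smul_mod=> [[|x s]] [sA ->]; first by rewrite big_nil.
by have := sA x (mem_head _ _).
Qed.

Lemma smul_mod1 (R : comNzRingType) (M : lmodType R) (f : R) (u : M) :
  u \in smul_mod M (mem [:: f]) -> exists v, u = f *: v.
Proof.
case/in_smul_mod=> s [sA ->]; exists (\sum_(x <- s) x.2).
rewrite scaler_sumr big_seq [RHS]big_seq.
by apply: eq_bigr => x /sA; rewrite inE => /eqP->.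
Qed.

Lemma mem_smul_mod (R : comNzRingType) (M : lmodType R) (A : {pred R}) a (u : M) :
  a \in A -> a *: u \in smul_mod M A.
Proof.
move=> aA; apply/asboolP; exists [:: (1, a *: u)]; rewrite big_seq1 scale1r.
by split=> // x; rewrite inE => /eqP->; exists a, u.
Qed.

(** Since [J M] is proper, the depth is the supremum of the lengths of regular sequences in [J]. If
    all lengths were at most 1, so would be the supremum; hence some sequence starts with two
    entries [f], [g]. *)
Lemma depth_gt1 (R : comNzRingType) (M : lmodType R) (J : {pred R}) :
  elt (Some 1%N) (depth M J) -> (exists u, u \notin smul_mod M J) ->
  exists f g, [/\ f \in J, g \in J, forall u : M, f *: u = 0 -> u = 0 &
    forall u v : M, g *: u = f *: v -> exists u', u = f *: u'].
Proof.
rewrite /depth => + [u0 Ju0].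
case: asboolP => [/(_ u0)|_]; first by rewrite (negPf Ju0).
move=> gt1; apply: contrapT => no_fg; case/negP: gt1.
apply: esup_le => _ [[|f [|g s]] [sJ [reg _] ->]] //; case: no_fg.
exists f, g; split; try by apply: sJ; rewrite !inE eqxx ?orbT.
- move=> u fu0; apply: smul_mod0; apply: (reg 0%N) => //=.
  by rewrite fu0 rpred0.
- move=> u v guv; apply: smul_mod1; have := reg 1%N isT u.
  by rewrite guv; apply; apply: mem_smul_mod; exact: mem_head.
Qed.

(** * Lifting from a quotient module to representatives *)

Section Quotient.
Variables (R : comNzRingType) (V : lmodType R) (S : submodClosed V).

Definition quot_pi (v : V) : quotmod S := \pi_(Quotient.quot (submod_zmod S)) v.

Lemma quot_piZ a v : quot_pi (a *: v) = a *: quot_pi v.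
Proof. exact: pi_scale. Qed.

Lemma quot_piD : {morph quot_pi : u v / u + v}.
Proof. by move=> u v; rewrite /quot_pi raddfD. Qed.

Lemma eq_quot_pi u v : quot_pi u = quot_pi v <-> u - v \in S.
Proof.
rewrite -[u - v \in S]/(u - v \in submod_zmod S) Quotient.idealrBE.
by split=> [/eqP|/eqP].
Qed.

Lemma quot_pi_surj (u : quotmod S) : exists v, u = quot_pi v.
Proof. by exists (repr u); rewrite /quot_pi reprK. Qed.

Lemma quot_pi0 : quot_pi 0 = 0.
Proof. by rewrite /quot_pi raddf0. Qed.

Lemma smul_mod_quot (A : {pred R}) v : quot_pi v \in smul_mod (quotmod S) A ->
  exists s : seq (R * V), (forall x, x \in s -> x.1 \in A) /\
    v - \sum_(x <- s) x.1 *: x.2 \in S.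
Proof.
case/in_smul_mod=> s [sA /= eqv].
have [t [tA eqt]]: exists t : seq (R * V), (forall x, x \in t -> x.1 \in A) /\
    quot_pi v = quot_pi (\sum_(x <- t) x.1 *: x.2).
  rewrite {}eqv; elim: s sA => [|[a u] s IHs] sA.
    by exists [::]; rewrite !big_nil quot_pi0.
  have [|t [tA eqt]] := IHs.
    by move=> x xs; apply: sA; rewrite inE xs orbT.
  have [u' ->] := quot_pi_surj u.
  exists ((a, u') :: t); split.
    by move=> x; rewrite inE => /predU1P[->|/tA]//; exact: (sA _ (mem_head _ _)).
  by rewrite !big_cons eqt quot_piD quot_piZ.
by exists t; split=> //; apply/eq_quot_pi.
Qed.

End Quotient.

(* A family phi with x_l phi_m = x_m phi_l modulo J represents a homomorphism
   from (x_l)_l to R/J; if (x_l)_l has grade at least 2 on R/J, then every such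
   homomorphism is a multiplication. *)
Lemma depth_gt1_hom (R : comNzRingType) (J : submodClosed R^o) (T : finType)
    (x phi : T -> R) (f g : R) :
    (forall l m, x l * phi m - x m * phi l \in J) ->
    (exists a, f = \sum_l a l * x l) -> (exists b, g = \sum_l b l * x l) ->
    (forall u, f * u \in J -> u \in J) ->
    (forall u v, g * u - f * v \in J -> exists h, u - f * h \in J) ->
  exists h, forall l, phi l - x l * h \in J.
Proof.
move=> Jphi [a fE] [b gE] f_reg g_reg.
have JM r p : p \in J -> r * p \in J by apply: (@rpredZ _ _ J).
(* The values of the homomorphism at [f] and [g]. *)
pose vf := \sum_l a l * phi l; pose vg := \sum_l b l * phi l.
have Jf l : x l * vf - f * phi l \in J.
  rewrite fE mulr_sumr mulr_suml -sumrB; apply: (@rpred_sum R^o J) => m _.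
  by rewrite (_ : _ - _ = a m * (x l * phi m - x m * phi l)) ?JM //; ring.
(* Modulo [J], g phi(f) = f phi(g), so regularity of [g] modulo [f] makes phi(f) a multiple of
   [f]. *)
have [h Jh] : exists h, vf - f * h \in J.
  apply: (g_reg _ vg); rewrite gE mulr_suml mulr_sumr -sumrB; apply: (@rpred_sum R^o J) => m _.
  by rewrite (_ : _ - _ = b m * (x m * vf - f * phi m)) ?JM //; ring.
(* After multiplication by [f], both f phi_l and f x_l h agree with x_l phi(f) modulo [J]; then [f]
   cancels. *)
exists h => l; apply: f_reg.
rewrite (_ : f * _ = x l * (vf - f * h) - (x l * vf - f * phi l)); last by ring.
by rewrite (@rpredB _ (submod_zmod J)) //; apply: JM.
Qed.

(** * Monomials occurring in the edge ideal and in its square *)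

Section EdgeIdeal.
Variables (k : fieldType) (n : nat) (H : hypergraph n).
Local Notation R := {mpoly k[n]}.
Local Notation Delta := (independence_complex H).
Local Notation I := (edge_ideal k H).
Local Notation I2 := (ideal_mul I I).

Lemma independentS (F G : {set 'I_n}) : F \subset G -> G \in Delta -> F \in Delta.
Proof.
rewrite !inE => FG /forall_inP indG; apply/forall_inP => E HE.
by apply: contra (indG E HE) => /subset_trans; apply.
Qed.

Lemma edge_monomial_in F : F \notin Delta -> edge_monomial k F \in I.
Proof.
rewrite inE negb_forall => /existsP[E]; rewrite negb_imply negbK => /andP[HE EF].
rewrite /edge_monomial (big_setID E) /= (setIidPr EF) mulrC.
apply/asboolP; exists [:: (\prod_(i in F :\: E) 'X_i, edge_monomial k E)].
by split=> [x|]; rewrite ?big_seq1 // inE => /eqP->; exists E.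
Qed.

Lemma edge_ideal_mul2 a b : a != b -> [set a; b] \notin Delta -> 'X_a * 'X_b \in I.
Proof.
by move=> ab /edge_monomial_in; rewrite /edge_monomial big_setU1 ?inE //= big_set1.
Qed.

Lemma ideal_mul_in (p q : R) : p \in I -> q \in I -> p * q \in I2.
Proof.
move=> pI qI; apply/asboolP; exists [:: (1, p * q)]; rewrite big_seq1 scale1r.
by split=> // x; rewrite inE => /eqP->; exists p, q.
Qed.

Lemma mcoeffMX_eq0 (r : R) (e m : 'X_{1..n}) :
  ~~ (e <= m)%MM -> (r * 'X_[e])@_m = 0.
Proof.
move=> nle; rewrite mcoeffM big1 // => -[k1 k2] /= /eqP mE; rewrite mcoeffX.
case: eqP => [ek2|_]; last by rewrite mulr0.
by case/negP: nle; rewrite mE ek2 lem_addl.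
Qed.

(** Each monomial of an element of I is divisible by some edge monomial, so its support contains an
    edge. *)
Lemma edge_ideal_mcoeff (p : R) (m : 'X_{1..n}) :
  p \in I -> [set l | (0 < m l)%N] \in Delta -> p@_m = 0.
Proof.
case/asboolP=> s [sE ->] ind; rewrite raddf_sum big_seq big1 //= => x /sE[F HF ->].
have -> : edge_monomial k F = 'X_[\sum_(i in F) U_(i)].
  by rewrite /edge_monomial mprodXE.
apply: mcoeffMX_eq0; move: ind; rewrite inE => /forall_inP/(_ F HF).
apply: contra => /mnm_lepP le; apply/subsetP=> i iF; rewrite inE.
by apply: leq_trans (le i); rewrite mnm_sumE (bigD1 i) //= mnm1E eqxx.
Qed.

(* If x^m = x^m1 x^m2 has degree at most 1 in x_i and its support is in {i, j},
   then one of the factors has independent support. *)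
Lemma edge_ideal_sqr_mcoeff (p : R) (i j : 'I_n) (m : 'X_{1..n}) :
    p \in I2 -> [set i] \in Delta -> [set j] \in Delta ->
    (m i <= 1)%N -> (forall l, l != i -> l != j -> m l = 0%N) ->
  p@_m = 0.
Proof.
case/asboolP=> s [sE ->] Di Dj mi m0; rewrite raddf_sum big_seq big1 //= => x /sE.
case=> a [b [aI bI ->]]; rewrite -[_ *: _]/(_ * _) mulrA.
have raI : x.1 * a \in I by apply: (@rpredZ _ _ I).
rewrite mcoeffM big1 // => -[m1 m2] /= /eqP/mnmP mE.
(* A factor free of x_i has support inside {j}, which is a face. *)
have ind m' : (forall l, m' l <= m l)%N -> m' i = 0%N ->
    [set l | (0 < m' l)%N] \in Delta.
  move=> le m'i; apply: independentS Dj; apply/subsetP => l; rewrite !inE.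
  apply: contraLR => lj; have [->|li] := eqVneq l i; first by rewrite m'i.
  by rewrite -leqNgt -(m0 l li lj).
have [m1i|m1i] := posnP (m1 i).
  rewrite (edge_ideal_mcoeff raI) ?mul0r // ind // => l.
  by rewrite mE mnmDE leq_addr.
rewrite (edge_ideal_mcoeff bI) ?mulr0 // ind // => [l|].
  by rewrite mE mnmDE leq_addl.
move: mi; rewrite mE mnmDE; case: (m1 i) m1i => // c _.
by case: (m2 i) => //= d; rewrite addnS.
Qed.

Lemma irrelevant_idealP (p : R) : p \in irrelevant_ideal k n ->
  exists a : 'I_n -> R, p = \sum_l a l * 'X_l.
Proof.
case/asboolP=> s [+ ->]; elim: s => [|[r q] s IHs] sE.
  by exists (fun=> 0); rewrite big_nil big1 // => l _; rewrite mul0r.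
have [|a eqa] := IHs; first by move=> x xs; apply: sE; rewrite inE xs orbT.
have [i /= ->] := sE _ (mem_head _ _).
exists (fun l => a l + (l == i)%:R * r); rewrite big_cons eqa /= addrC.
under [RHS]eq_bigr do rewrite mulrDl.
rewrite big_split /=; congr (_ + _).
rewrite (bigD1 i) //= eqxx mul1r big1 ?addr0 // => l /negPf->.
by rewrite !mul0r.
Qed.

Lemma irrelevant_ideal_mcoeff0 (p : R) : p \in irrelevant_ideal k n -> p@_0%MM = 0.
Proof.
case/irrelevant_idealP=> a ->; rewrite raddf_sum big1 //= => l _.
apply: mcoeffMX_eq0; apply/negP => /mnm_lepP/(_ l).
by rewrite mnm1E mnm0E eqxx.
Qed.

(** The class of 1 is the witness: a vertex [i] forces elements of I^2 to have zero constant term,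
    as do those of the irrelevant ideal. *)
Lemma quot_sqr_irrelevant_proper i : [set i] \in Delta ->
  exists u : quotmod I2, u \notin smul_mod (quotmod I2) (irrelevant_ideal k n).
Proof.
move=> Di; exists (quot_pi I2 1); apply/negP => /smul_mod_quot[s [sm]].
move/edge_ideal_sqr_mcoeff => /(_ i i 0%MM Di Di).
rewrite mnm0E => /(_ isT (fun l _ _ => mnm0E l)).
rewrite mcoeffB mcoeff1 eqxx raddf_sum big_seq big1 => [|x /sm xm] /=.
  by rewrite subr0 => /eqP; rewrite oner_eq0.
apply: irrelevant_ideal_mcoeff0.
rewrite -[_ *: _]/(x.1 * x.2) mulrC.
exact: (@rpredZ _ _ (irrelevant_ideal k n)).
Qed.

Lemma depth_sqr_gt1_common_neighbor (i j : 'I_n) :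
    elt (Some 1%N) (depth (quotmod I2) (irrelevant_ideal k n)) ->
    [set i] \in Delta -> [set j] \in Delta -> [set i; j] \notin Delta ->
  exists l, [/\ l != i, l != j, [set i; l] \in Delta & [set j; l] \in Delta].
Proof.
move=> gt1 Di Dj NDij; apply: contrapT => no_l.
have ij : i != j by apply: contraNneq NDij => <-; rewrite setUid.
have [f [g [fm gm f_reg g_reg]]] := depth_gt1 gt1 (quot_sqr_irrelevant_proper Di).
pose S l := [set i; l] \in Delta.
have Si : S i by rewrite /S setUid.
have NSj : ~~ S j by [].
have inI_i l : ~~ S l -> 'X_i * 'X_l \in I.
  move=> NSl; apply: edge_ideal_mul2 => //.
  by apply: contraNneq NSl => <-.
(* If {j, l} were a face, [l] would be a common neighbour of [i] and [j]. *)
have inI_j l : S l -> 'X_j * 'X_l \in I.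
  move=> Sl; apply: edge_ideal_mul2; first by apply: contraNneq NSj => ->.
  apply/negP => Djl; case: no_l; exists l; split=> //.
    by apply: contraNneq NDij => <-; rewrite setUC.
  by apply: contraNneq NSj => <-.
pose w : R := 'X_i * 'X_j.
have mixed l m : S l -> ~~ S m -> w * 'X_l * 'X_m \in I2.
  move=> /inI_j jl /inI_i im.
  rewrite (_ : _ * _ = 'X_j * 'X_l * ('X_i * 'X_m)); last by rewrite /w; ring.
  exact: ideal_mul_in.
(* The boolean [S l] serves as a factor 0 or 1. The compatibility condition has content only when
   exactly one of [l], [m] lies in [S]; otherwise the difference is 0. *)
have [h Jh] : exists h : R, forall l, (S l)%:R * ('X_l * w) - 'X_l * h \in I2.
  apply: (depth_gt1_hom (x := fun l => 'X_l) (f := f) (g := g)).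
  - move=> l m; case Sl: (S l); case Sm: (S m); rewrite ?mul1r ?mul0r.
    + by rewrite (_ : _ - _ = 0) ?rpred0 //; ring.
    + rewrite (_ : _ - _ = - (w * 'X_l * 'X_m)); last by ring.
      by rewrite (@rpredN _ (submod_zmod I2)); apply: mixed; rewrite ?Sl ?Sm.
    + rewrite (_ : _ - _ = w * 'X_m * 'X_l); last by ring.
      by apply: mixed; rewrite ?Sl ?Sm.
    + by rewrite (_ : _ - _ = 0) ?rpred0 //; ring.
  - exact: irrelevant_idealP.
  - exact: irrelevant_idealP.
  - move=> u fu; have := f_reg (quot_pi I2 u).
    rewrite -quot_piZ -[0](quot_pi0 I2) => fu0.
    by rewrite -[u]subr0; apply/eq_quot_pi/fu0/eq_quot_pi; rewrite subr0.
  - move=> u v guv; have [|u'] := g_reg (quot_pi I2 u) (quot_pi I2 v).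
      by rewrite -!quot_piZ; apply/eq_quot_pi.
    by have [h ->] := quot_pi_surj u'; rewrite -quot_piZ => /eq_quot_pi; exists h.
pose mw := (U_(i) + U_(j))%MM.
have mw0 l : l != i -> l != j -> mw l = 0%N.
  by move=> li lj; rewrite mnmDE !mnm1E !(eq_sym _ l) (negPf li) (negPf lj).
have wE : w = 'X_[mw] by rewrite mpolyXD.
have hw : h@_mw = 1.
  have := Jh i; rewrite Si mul1r -mulrBr mulrC => /edge_ideal_sqr_mcoeff.
  (* The monomial x_i w = x_i^2 x_j has degree 1 in x_j, not in x_i, so [i] and [j] exchange roles
     here. *)
  move=> /(_ j i (U_(i) + mw)%MM Dj Di); rewrite mcoeffMX mcoeffB wE mcoeffX eqxx.
  move=> E; apply/eqP; rewrite eq_sym -subr_eq0; apply/eqP/E.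
    by rewrite !mnmDE !mnm1E (negPf ij) eqxx.
  by move=> l lj li; rewrite mnmDE mw0 // mnm1E eq_sym (negPf li).
have := Jh j; rewrite (negPf NSj) mul0r sub0r mulrC -mulNr.
move/edge_ideal_sqr_mcoeff.
move=> /(_ i j (U_(j) + mw)%MM Di Dj); rewrite mcoeffMX mcoeffN hw.
move=> E; case/eqP: (oner_neq0 k); apply/eqP; rewrite -oppr_eq0; apply/eqP/E.
  by rewrite !mnmDE !mnm1E eqxx eq_sym (negPf ij).
by move=> l li lj; rewrite mnmDE mw0 // mnm1E eq_sym (negPf lj).
Qed.

End EdgeIdeal.

Theorem theorem4p3 (k : fieldType) (n : nat) (H : hypergraph n) :
  let I := edge_ideal k H in
  elt (Some 1%N)
      (depth (quotmod (ideal_mul I I)) (irrelevant_ideal k n)) ->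
  ele (diameter (skeleton1 H)) (Some 2%N).
Proof.
move=> I gt1; apply: esup_le => _ [i [j [+ + ->]]]; rewrite !inE => Di Dj.
(* The distance is a minimum over walks, so one walk of length at most 2 bounds it. *)
suff [p [pp pl ps]] : exists p, [/\ path (adj (skeleton1 H)) i p, last i p = j &
    (size p <= 2)%N].
  have : ele (distance (skeleton1 H) i j) (Some (size p)).
    by apply: einf_le; exists p.
  by case: distance => [d|//] /leq_trans; apply.
have [<-|ij] := eqVneq i j; first by exists [::].
have [Dij|NDij] := boolP ([set i; j] \in independence_complex H).
  by exists [:: j]; split=> //=; rewrite /skeleton_adj ij Dij.
have [||l [li lj Dil Djl]] := depth_sqr_gt1_common_neighbor gt1 _ _ NDij.
- by rewrite inE.
- by rewrite inE.
exists [:: l; j]; split=> //=.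
by rewrite /skeleton_adj eq_sym li Dil lj setUC Djl.
Qed.
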